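(* Given a string $T$ of length $n$ and a string attractor $\Gamma$ of size $\gamma$ for $T$, one can build a bidirectional parse (and therefore a macro scheme) for $T$ of size $\mathcal{O}(\gamma\log(n/\gamma))$.
   Context: A string attractor of $T$ is a set $\Gamma\subseteq\{1,\dots,n\}$ such that every substring $T[i..j]$ has an occurrence $T[i'..j']=T[i..j]$ with $p\in[i',j']$ for some $p\in\Gamma$. A macro scheme of size $b$ for $T$ is a set of $b$ directives, each of the form $T[i..j]\leftarrow T[i'..j']$ (copy) or $T[i]\leftarrow c$ (assign character $c$), such that $T$ can be unambiguously decoded from the directives (every position is resolved by a finite chain of copies ending in an assignment). A bidirectional parse is a macro scheme whose left-hand sides form a factorization of $T$ (they cover all of $T$ and do not overlap); its size is its number of directives (phrases).
   Formalization: The logarithm log(n/γ) is read as max(1, log₂(n/γ)), since the literal bound fails when γ is close to n: for n distinct characters γ = n gives log(n/γ) = 0, yet n phrases are needed. *)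

(* Defs.v *)
From HB Require Import structures.
From mathcomp Require Import all_boot all_order all_algebra.
From mathcomp Require Import reals exp.

Set Implicit Arguments.
Unset Strict Implicit.
Unset Printing Implicit Defensive.

(* Positions of a string of length n are the ordinals 'I_n, i.e. the usual
   positions 1, ..., n shifted down by one. *)

(* T[i..j], both ends included. *)
Definition substring (A : Type) (n : nat) (T : n.-tuple A) (i j : 'I_n) : seq A :=
  take (j.+1 - i) (drop i T).

Definition string_attractor (A : Type) (n : nat) (T : n.-tuple A)
    (Gamma : {set 'I_n}) : Prop :=
  forall i j : 'I_n, i <= j ->
  exists i' j' : 'I_n,
    [/\ i' <= j',
        substring T i' j' = substring T i j
      & exists2 p, p \in Gamma & i' <= p <= j'].

(* [Copy i j i' j'] is T[i..j] <- T[i'..j'], and [Assign i c] is T[i] <- c. *)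
Inductive directive (A : Type) (n : nat) : Type :=
| Copy of 'I_n & 'I_n & 'I_n & 'I_n
| Assign of 'I_n & A.
Arguments Copy {A n}.
Arguments Assign {A n}.

Section DirectiveEqType.
Variables (A : eqType) (n : nat).

Definition directive_code (d : directive A n) :
    'I_n * 'I_n * ('I_n * 'I_n) + 'I_n * A :=
  match d with
  | Copy i j i' j' => inl (i, j, (i', j'))
  | Assign i c => inr (i, c)
  end.

Definition directive_decode (s : 'I_n * 'I_n * ('I_n * 'I_n) + 'I_n * A) :
    directive A n :=
  match s with
  | inl (i, j, (i', j')) => Copy i j i' j'
  | inr (i, c) => Assign i c
  end.

Lemma directive_codeK : cancel directive_code directive_decode.
Proof. by case. Qed.

HB.instance Definition _ :=
  Equality.copy (directive A n) (can_type directive_codeK).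
End DirectiveEqType.

Definition wf_directive (A : Type) (n : nat) (d : directive A n) : bool :=
  match d with
  | Copy i j i' j' => [&& i <= j, i' <= j' & j - i == j' - i']
  | Assign _ _ => true
  end.

Definition in_lhs (A : Type) (n : nat) (d : directive A n) (p : 'I_n) : bool :=
  match d with
  | Copy i j _ _ => i <= p <= j
  | Assign i _ => p == i
  end.

(* [resolves D p c]: a finite chain of copies of D starting at position p ends
   in an assignment of the character c. The equation [q + i = p + i'] says that
   q is at the same offset in T[i'..j'] as p is in T[i..j]. *)
Inductive resolves (A : eqType) (n : nat) (D : seq (directive A n)) :
    'I_n -> A -> Prop :=
| resolves_assign p c : Assign p c \in D -> resolves D p c
| resolves_copy (i j i' j' p q : 'I_n) c :
    Copy i j i' j' \in D -> i <= p <= j -> q + i = p + i' ->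
    resolves D q c -> resolves D p c.

(* The equivalence expresses unambiguous decodability: every position is
   resolved, and only to the character of T at that position. The size of the
   macro scheme is [size D], D being duplicate-free. *)
Definition macro_scheme (A : eqType) (n : nat) (T : n.-tuple A)
    (D : seq (directive A n)) : Prop :=
  [/\ uniq D,
      all (@wf_directive A n) D
    & forall p c, resolves D p c <-> c = tnth T p].

Definition lhs_factorization (A : eqType) (n : nat)
    (D : seq (directive A n)) : Prop :=
  (forall p : 'I_n, exists2 d, d \in D & in_lhs d p) /\
  (forall d1 d2, d1 \in D -> d2 \in D -> d1 != d2 ->
     forall p : 'I_n, ~~ (in_lhs d1 p && in_lhs d2 p)).

Definition bidirectional_parse (A : eqType) (n : nat) (T : n.-tuple A)
    (D : seq (directive A n)) : Prop :=
  macro_scheme T D /\ lhs_factorization D.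

(* Logarithm truncated below at 1, as is implicit in bounds of the form
   O(g log(n/g)): when n/g is close to 1, log(n/g) is close to 0, whereas a
   string with g distinct characters needs at least g directives. *)
Definition log2_ge1 (R : realType) (x : R) : R :=
  Num.max 1%R (ln x / ln 2%:R)%R.

(* Main.v *)
Require Import Defs.
From HB Require Import structures.
From mathcomp Require Import all_boot all_order all_algebra.
From mathcomp Require Import reals exp.
From mathcomp Require Import zify.

Set Implicit Arguments.
Unset Strict Implicit.
Unset Printing Implicit Defensive.
Import Order.TTheory GRing.Theory Num.Theory.

(** Cut T at every position at distance 2^k from an attractor position, for
    2^k up to about n / #|Gamma|, and at the multiples of some
    M ~ n / #|Gamma|.  A phrase other than a single attractor position is then
    no longer than its distance to Gamma.  Copying it from an occurrence that
    crosses Gamma brings every position strictly closer to Gamma, so that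
    chains of copies end at attractor positions, which are the assigned ones. *)

Lemma size_substring (A : Type) (n : nat) (T : n.-tuple A) (i j : 'I_n) :
  size (substring T i j) = j.+1 - i.
Proof.
rewrite /substring size_take size_drop size_tuple.
by have := ltn_ord j; case: ifP; lia.
Qed.

Lemma tnth_substring (A : Type) (n : nat) (T : n.-tuple A) (i j i' j' p q : 'I_n) :
  substring T i' j' = substring T i j -> i <= p <= j -> q + i = p + i' ->
  tnth T q = tnth T p.
Proof.
move=> eqT pij qp.
have szE : j'.+1 - i' = j.+1 - i by rewrite -!(size_substring T) eqT.
have x0 := tnth T p.
have := congr1 (fun s => nth x0 s (p - i)) eqT.
rewrite /substring !nth_take ?nth_drop; try lia.
rewrite !(tnth_nth x0).
have -> : i + (p - i) = p by lia.
by have -> : i' + (p - i) = q by lia.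
Qed.

(** * From a set of phrase starts to a bidirectional parse *)

Section ParseOfBoundaries.
Variables (A : eqType) (n : nat) (T : n.-tuple A) (Gamma B : {set 'I_n}).

(** A cut is the first position of a phrase, so the interval is open at [s]. *)
Let uncut (s e : 'I_n) := [forall b in B, ~~ (s < b <= e)].

Hypothesis attT : string_attractor T Gamma.
Hypothesis B0 : forall p : 'I_n, p = 0 :> nat -> p \in B.
Hypothesis BGamma : forall s e a : 'I_n, s <= e ->
  {in B, forall b : 'I_n, ~~ (s < b <= e)} -> a \in Gamma ->
  [|| (s == a) && (e == a), e.+1 - s <= s - a | e.+1 - s <= a - e].

(** Stated for every [s], in [B] or not, so that finite choice gives a total function. The last
    clause makes chains of copies terminate. *)
Let phrase_spec (s : 'I_n) (d : directive A n) :=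
  exists e : 'I_n,
    [/\ s <= e, forall p : 'I_n, s <= p -> (p <= e) = uncut s p
      & (e = s /\ d = Assign s (tnth T s)) \/
        exists i' j' : 'I_n,
          [/\ d = Copy s e i' j', i' <= j',
              substring T i' j' = substring T s e,
              exists2 g, g \in Gamma & i' <= g <= j'
            & forall a, a \in Gamma ->
                (e.+1 - s <= s - a) || (e.+1 - s <= a - e)]].

Let phrase_exists (s : 'I_n) : exists d, phrase_spec s d.
Proof.
have uss : uncut s s by apply/forall_inP => b _; lia.
pose e := [arg max_(e > s | (s <= e) && uncut s e) (e : nat)].
have [se ue emax] : [/\ s <= e, uncut s e
    & forall p : 'I_n, s <= p -> uncut s p -> p <= e].
  rewrite /e; case: arg_maxnP => [|i /andP[? ?] im]; first by rewrite leqnn.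
  by split=> // p sp up; apply: im; rewrite sp.
have eE (p : 'I_n) : s <= p -> (p <= e) = uncut s p.
  move=> sp; apply/idP/idP => [pe|]; last exact: emax.
  apply/forall_inP => b bB; have /forall_inP/(_ b bB) := ue; lia.
have [sG|sG] := boolP (s \in Gamma).
  exists (Assign s (tnth T s)), e; split=> //; left; split=> //.
  (* With [a = s] both distances are 0 while the length is positive, so the phrase is a single
     position. *)
  have := BGamma se (elimT forall_inP ue) sG.
  by case/or3P => [/andP[_ /eqP]//| |] h; apply: ord_inj; lia.
have [i' [j' [ij eqT gG]]] := attT se.
exists (Copy s e i' j'), e; split=> //; right; exists i', j'; split=> // a aG.
have /or3P[/andP[/eqP sa _]|->|->] := BGamma se (elimT forall_inP ue) aG => //.
  by rewrite sa aG in sG.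
by rewrite orbT.
Qed.

Lemma parse_of_boundaries :
  exists2 D : seq (directive A n), bidirectional_parse T D & size D = #|B|.
Proof.
have [f fP] := fin_all_exists phrase_exists.
have lhsE s p : in_lhs (f s) p = (s <= p) && uncut s p.
  have [e [se eE [[es ->]|[i' [j' [-> _ _ _ _]]]]]] := fP s => /=.
    case: leqP => [sp|ps] /=; last by apply/eqP => h; move: ps; rewrite h ltnn.
    by rewrite -eE // es -(inj_eq val_inj) /= eqn_leq sp andbT.
  by case: leqP => //= sp; rewrite eE.
have uncut_self s : uncut s s by apply/forall_inP => b _; lia.
(* Of two distinct starts, the larger would be a cut inside the phrase of the smaller. *)
have disj (s1 s2 p : 'I_n) : s1 \in B -> s2 \in B ->
    in_lhs (f s1) p -> in_lhs (f s2) p -> s1 = s2.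
  rewrite !lhsE => b1 b2 /andP[l1 /forall_inP/(_ _ b2) u1].
  by move=> /andP[l2 /forall_inP/(_ _ b1) u2]; apply: ord_inj; lia.
have f_inj : {in B &, injective f}.
  move=> s1 s2 b1 b2 eqf.
  by apply: (disj _ _ s1) => //; rewrite -?eqf lhsE leqnn uncut_self.
(* The phrase covering [p] starts at the last cut not after [p]. *)
have cover p : exists2 s, s \in B & in_lhs (f s) p.
  have n0 : 0 < n by apply: leq_ltn_trans (ltn_ord p).
  pose o := Ordinal n0.
  have oB : (o \in B) && (o <= p) by rewrite B0.
  pose s := [arg max_(s > o | (s \in B) && (s <= p)) (s : nat)].
  have [sB sp smax] : [/\ s \in B, s <= p
      & forall b : 'I_n, b \in B -> b <= p -> b <= s].
    rewrite /s; case: arg_maxnP => [//|i /andP[? ?] im].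
    by split=> // b bB bp; apply: im; rewrite bB.
  exists s => //; rewrite lhsE sp; apply/forall_inP => b bB.
  by have := smax b bB; lia.
exists [seq f s | s <- enum B]; last by rewrite size_map cardE.
have DP d : reflect (exists2 s, s \in B & d = f s) (d \in [seq f s | s <- enum B]).
  apply: (iffP mapP) => [] [s sB ->]; exists s => //; by rewrite mem_enum in sB *.
split; last first.
  split=> [p|d1 d2 /DP[s1 b1 ->] /DP[s2 b2 ->] ne p].
    by have [s sB sp] := cover p; exists (f s) => //; apply/DP; exists s.
  by apply/negP => /andP[l1 l2]; rewrite (disj _ _ _ b1 b2 l1 l2) eqxx in ne.
split.
- rewrite map_inj_in_uniq ?enum_uniq // => x y.
  by rewrite !mem_enum; apply: f_inj.
- apply/allP => d /DP[s _ ->].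
  have [e [se _ [[_ ->]|[i' [j' [-> ij eqT _ _]]]]]] := fP s => //=.
  rewrite se ij; have := congr1 size eqT; rewrite !size_substring; lia.
- move=> p c; split.
    elim=> {p c} [p c /DP[s _ fs]|i j i' j' p q c /DP[s _ fs] pij qp _ ->].
      have [e [_ _ [[_ eqf]|[i1 [j1 [eqf _ _ _ _]]]]]] := fP s;
        by rewrite eqf in fs; case: fs => // -> ->.
    have [e [_ _ [[_ eqf]|[i1 [j1 [eqf _ eqT _ _]]]]]] := fP s;
      rewrite eqf in fs; case: fs => // ? ? ? ?; subst.
    exact: tnth_substring eqT pij qp.
  move=> ->.
  (* This only provides some attractor position; the induction is on the distance from [p] to it. *)
  have [i' [j' [_ _ [a aG _]]]] := attT (leqnn p).
  have [m] := ubnP ((p - a) + (a - p)).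
  elim: m p a aG {i' j'} => // m IHm p a aG dist_pa.
  have [s sB] := cover p; rewrite lhsE => /andP[sp up].
  have fD : f s \in [seq f s | s <- enum B] by apply/DP; exists s.
  have [e [se eE [[es eqf]|[i' [j' [eqf ij eqT [g gG gij] far]]]]]] := fP s.
    have -> : p = s by apply: ord_inj; have := eE p sp; rewrite up es; lia.
    by apply: resolves_assign; rewrite -eqf.
  have pe : p <= e by rewrite eE.
  have szE : j'.+1 - i' = e.+1 - s by rewrite -!(size_substring T) eqT.
  have qn : i' + (p - s) < n by have := ltn_ord j'; lia.
  pose q := Ordinal qn.
  have qp : q + s = p + i' by rewrite /q /=; lia.
  apply: (@resolves_copy _ _ _ s e i' j' p q); rewrite -?eqf ?sp //.
  rewrite -(tnth_substring eqT _ qp) ?sp //.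
  (* Both [q] and [g] lie in [[i', j']], so their distance is below the phrase length, which is at
     most the distance from [p] to [a]. *)
  by apply: (IHm q g gG); have := far a aG; lia.
Qed.

End ParseOfBoundaries.

(** * Cuts at powers of two around the attractor *)

Section DyadicBoundaries.
Variables (n : nat) (Gamma : {set 'I_n}) (M K : nat).

Definition dyadic_cuts : seq nat :=
  [seq M * i | i <- iota 0 (n %/ M).+1] ++
  [seq a + 2 ^ k | a : 'I_n <- enum Gamma, k <- iota 0 K.+1] ++
  (* truncates to 0, which is a cut anyway *)
  [seq a.+1 - 2 ^ k | a : 'I_n <- enum Gamma, k <- iota 0 K.+1].

Lemma size_dyadic_cuts :
  size dyadic_cuts = (n %/ M).+1 + #|Gamma| * K.+1 * 2.
Proof.
rewrite !size_cat size_map !size_allpairs !size_iota -!cardE.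
by rewrite muln2 addnn.
Qed.

Hypothesis M_gt0 : 0 < M.

Lemma multiple_cut (p : nat) : p < n -> M %| p -> p \in dyadic_cuts.
Proof.
move=> pn /dvdnP[i pE]; rewrite mem_cat; apply/orP; left; apply/mapP.
exists i; last by rewrite pE mulnC.
by rewrite mem_iota /= add0n ltnS leq_divRL // -pE ltnW.
Qed.

Lemma right_cut (a : 'I_n) k : a \in Gamma -> k <= K -> a + 2 ^ k \in dyadic_cuts.
Proof.
move=> aG kK; rewrite !mem_cat; apply/orP; right; apply/orP; left.
by apply/allpairsP; exists (a, k); rewrite mem_enum mem_iota; split.
Qed.

Lemma left_cut (a : 'I_n) k : a \in Gamma -> k <= K -> a.+1 - 2 ^ k \in dyadic_cuts.
Proof.
move=> aG kK; rewrite !mem_cat; apply/orP; right; apply/orP; right.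
by apply/allpairsP; exists (a, k); rewrite mem_enum mem_iota; split.
Qed.

Hypothesis M_le : M <= 2 ^ K.

Lemma dyadic_uncut (s e a : 'I_n) : s <= e ->
  {in dyadic_cuts, forall b, ~~ (s < b <= e)} -> a \in Gamma ->
  [|| (s == a) && (e == a), e.+1 - s <= s - a | e.+1 - s <= a - e].
Proof.
move=> se ucut aG.
(* Otherwise the first multiple of [M] after [s] would cut the phrase. *)
have len : e.+1 - s <= M.
  rewrite leqNgt; apply/negP => lt.
  have sb : s < (s %/ M).+1 * M by apply: ltn_ceil.
  have bs : (s %/ M) * M <= s by apply: leq_divM.
  have be : (s %/ M).+1 * M <= e by rewrite mulSn; lia.
  have := ucut _ (multiple_cut (leq_ltn_trans be (ltn_ord e)) (dvdn_mull _ (dvdnn M))).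
  by rewrite sb be.
case: (ltnP a s) => [as_|sa].
  apply/or3P; constructor 2.
  have d0 : 0 < s - a by lia.
  have /andP[lo hi] := trunc_log_bounds (isT : 1 < 2) d0.
  (* Let [d = s - a] and [2^k <= d < 2^(k+1)]. If [K <= k], the length is at most [M <= 2^K <= d].
     Otherwise the cut [a + 2^(k+1)] lies beyond [e], so the length is at most
     [2^(k+1) - d <= d]. *)
  case: (leqP K (trunc_log 2 (s - a))) => [Kk|kK].
    by have := leq_pexp2l (isT : 0 < 2) Kk; lia.
  by have := ucut _ (right_cut aG kK); rewrite expnS in hi *; lia.
(* Mirror image: the phrase before a left cut ends at distance [2^k] from [a], which is why these
   cuts use [a.+1]. *)
case: (ltnP e a) => [ea|ae].
  apply/or3P; constructor 3.
  have d0 : 0 < a - e by lia.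
  have /andP[lo hi] := trunc_log_bounds (isT : 1 < 2) d0.
  case: (leqP K (trunc_log 2 (a - e))) => [Kk|kK].
    by have := leq_pexp2l (isT : 0 < 2) Kk; lia.
  by have := ucut _ (left_cut aG kK); rewrite expnS in hi *; lia.
(* Here [s <= a <= e], and the cuts for [k = 0], at [a] and [a + 1], isolate [a]. *)
have := ucut _ (right_cut aG (leq0n K)); have := ucut _ (left_cut aG (leq0n K)).
rewrite expn0 -!(inj_eq val_inj) /=; lia.
Qed.

End DyadicBoundaries.

(** * Counting phrases and choosing the parameters *)

Lemma attractor_parse (A : eqType) (n : nat) (T : n.-tuple A)
    (Gamma : {set 'I_n}) (M K : nat) :
  string_attractor T Gamma -> 0 < M -> M <= 2 ^ K ->
  exists2 D : seq (directive A n), bidirectional_parse T D &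
    size D <= (n %/ M).+1 + #|Gamma| * K.+1 * 2.
Proof.
move=> attT M0 MK.
pose B := [set p : 'I_n | (p : nat) \in dyadic_cuts Gamma M K].
have B0 (p : 'I_n) : p = 0 :> nat -> p \in B.
  by move=> p0; rewrite inE multiple_cut // p0.
have BGamma (s e a : 'I_n) : s <= e ->
    {in B, forall b : 'I_n, ~~ (s < b <= e)} -> a \in Gamma ->
    [|| (s == a) && (e == a), e.+1 - s <= s - a | e.+1 - s <= a - e].
  (* Cuts outside the string are lost in [B], but one in [(s, e]] is below [n]. *)
  move=> se ucut; apply: (dyadic_uncut M0 MK se) => b bc.
  apply/negP => /andP[sb be].
  have := ucut (Ordinal (leq_ltn_trans be (ltn_ord e))).
  by rewrite inE /= sb be => /(_ bc).
have [D DT szD] := parse_of_boundaries attT B0 BGamma.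
exists D => //; rewrite szD -size_dyadic_cuts cardE -(size_map val).
apply: uniq_leq_size => [|_ /mapP[p pB ->]].
  by rewrite (map_inj_uniq val_inj) enum_uniq.
by rewrite mem_enum inE in pB.
Qed.

(** With [g = #|Gamma|], take [M = n %/ g + 1] and [K = t + 1]: there are at most [g] multiples of
    [M] to count, and [g + 2 * g * (t + 2) = g * (2 * t + 5)]. *)
Lemma attractor_parse_trunc_log (A : eqType) (n : nat) (T : n.-tuple A)
    (Gamma : {set 'I_n}) :
  string_attractor T Gamma -> 0 < #|Gamma| ->
  exists2 D : seq (directive A n), bidirectional_parse T D &
    size D <= #|Gamma| * (2 * trunc_log 2 (n %/ #|Gamma|) + 5).
Proof.
move=> attT G0; set g := #|Gamma| in G0 *; set t := trunc_log _ _.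
have MK : (n %/ g).+1 <= 2 ^ t.+1 by apply: trunc_log_ltn.
have [D DT szD] := attractor_parse attT (ltn0Sn _) MK.
exists D => //; apply: leq_trans szD _; rewrite -/g.
have : n %/ (n %/ g).+1 < g by rewrite ltn_divLR // mulnC ltn_ceil.
by nia.
Qed.

(** * Passage to the real logarithm *)

Local Open Scope ring_scope.

Lemma trunc_log_le_log2 (R : realType) (n g : nat) : (0 < g)%N -> (g <= n)%N ->
  (trunc_log 2 (n %/ g))%:R <= ln (n%:R / g%:R) / ln 2%:R :> R.
Proof.
move=> g0 gn; set t := trunc_log _ _.
have t_le : (2 ^ t * g <= n)%N.
  by rewrite -leq_divRL //; apply: trunc_logP; rewrite // divn_gt0.
have ln2 : 0 < ln 2%:R :> R by rewrite ln_gt0 // ltr1n.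
rewrite ler_pdivlMr // (mulr_natl (ln _)) -lnXn ?ltr0n // ler_ln ?posrE.
- by rewrite ler_pdivlMr ?ltr0n // -natrX -natrM ler_nat.
- by rewrite exprn_gt0 ?ltr0n.
- by rewrite divr_gt0 ?ltr0n // (leq_trans g0).
Qed.

Theorem theorem3p12 (R : realType) :
  exists2 C : R, 0 < C &
    forall (A : eqType) (n : nat) (T : n.-tuple A) (Gamma : {set 'I_n}),
      string_attractor T Gamma ->
      exists2 D : seq (directive A n), bidirectional_parse T D &
        (size D)%:R <= C * (#|Gamma|%:R * log2_ge1 (n%:R / #|Gamma|%:R)).
Proof.
(* The factor [2 * t + 5] is at most [7 * L], since the truncated logarithm [L] is at least both [t]
   and 1. *)
exists 7%:R; first by rewrite ltr0n.
move=> A n T Gamma attT.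
have [n0|n_gt0] := posnP n.
  exists [::]; last first.
    by rewrite !mulr_ge0 ?ler0n // /log2_ge1 le_max ler01.
  have noI : 'I_n -> False by rewrite n0; case.
  by split; split=> // p; case: (noI p).
have G0 : (0 < #|Gamma|)%N.
  pose o := Ordinal n_gt0.
  have [_ [_ [_ _ [g gG _]]]] := attT o o (leqnn o).
  by apply/card_gt0P; exists g.
have Gn : (#|Gamma| <= n)%N by rewrite -[leqRHS]card_ord max_card.
have [D DT szD] := attractor_parse_trunc_log attT G0.
exists D => //.
apply: (@le_trans _ _ (#|Gamma| * (2 * trunc_log 2 (n %/ #|Gamma|) + 5))%:R).
  by rewrite ler_nat.
rewrite natrM mulrCA ler_wpM2l ?ler0n // natrD natrM.
set L := log2_ge1 _.
have L1 : 1 <= L by rewrite /L /log2_ge1 le_max lexx.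
have tL : (trunc_log 2 (n %/ #|Gamma|))%:R <= L.
  by rewrite /L /log2_ge1 le_max trunc_log_le_log2 ?orbT.
have -> : 7%:R = 2%:R + 5%:R :> R by rewrite -natrD.
rewrite [leRHS]mulrDl; apply: lerD.
  by rewrite ler_wpM2l ?ler0n.
by rewrite ler_peMr ?ler0n.
Qed.
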